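(* Let $S$ be a $z$-Noetherian semiring. Then every $z$-ideal of $S$ can be represented as an intersection of a finite number of $z$-irreducible ideals of $S$.
   Context: A (commutative) semiring is a system $(S,+,0,\cdot,1)$ with $(S,+,0)$ and $(S,\cdot,1)$ commutative monoids, $0s=0$ for all $s\in S$, and multiplication distributing over addition. An ideal of $S$ is a nonempty subset closed under addition and under multiplication by elements of $S$. $\mathrm{Max}(S)$ is the set of maximal (proper) ideals of $S$, and for $x\in S$, $\mathcal{M}_x=\{\mathfrak{m}\in\mathrm{Max}(S)\mid x\in\mathfrak{m}\}$. An ideal $\mathfrak{z}$ of $S$ is a $z$-ideal if $\bigcap\mathcal{M}_x\subseteq\mathfrak{z}$ for every $x\in\mathfrak{z}$ (the intersection of the empty family is $S$). A $z$-ideal $\mathfrak{a}$ is $z$-irreducible if for all $z$-ideals $\mathfrak{b},\mathfrak{b}'$ of $S$, $\mathfrak{b}\cap\mathfrak{b}'=\mathfrak{a}$ implies $\mathfrak{b}=\mathfrak{a}$ or $\mathfrak{b}'=\mathfrak{a}$. $S$ is $z$-Noetherian if every ascending chain of $z$-ideals of $S$ is eventually stationary. *)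

(* Defs.v *)
From HB Require Import structures.
From mathcomp Require Import all_boot all_order all_algebra.
From mathcomp Require Import all_classical.

Set Implicit Arguments.
Unset Strict Implicit.
Unset Printing Implicit Defensive.

Import GRing.Theory.
Local Open Scope classical_set_scope.
Local Open Scope ring_scope.

(* Semirings are [comPzSemiRingType]: commutative, with [0 = 1] allowed.      *)
(* Ideals are Prop-valued sets, not necessarily proper.                       *)

Section ZIdeals.
Variable S : comPzSemiRingType.
Implicit Types (a b m : set S) (x s : S).

Definition ideal a : Prop :=
  [/\ a !=set0,
      forall x y, a x -> a y -> a (x + y)
    & forall s x, a x -> a (s * x)].

Definition maximal_ideal m : Prop :=
  [/\ ideal m, m <> setT
    & forall b, ideal b -> m `<=` b -> b = m \/ b = setT].

Definition maximal_ideals_at x : set (set S) :=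
  [set m | maximal_ideal m /\ m x].

(* [\bigcap] over the empty family is [setT]. *)
Definition z_ideal a : Prop :=
  ideal a /\
  forall x, a x -> \bigcap_(m in maximal_ideals_at x) m `<=` a.

Definition z_irreducible a : Prop :=
  z_ideal a /\
  forall b b', z_ideal b -> z_ideal b' -> b `&` b' = a -> b = a \/ b' = a.

Definition z_noetherian : Prop :=
  forall I : nat -> set S,
    (forall n, z_ideal (I n)) -> (forall n, I n `<=` I n.+1) ->
    exists N, forall n, (N <= n)%N -> I n = I N.

End ZIdeals.

Arguments z_noetherian : clear implicits.

(* Main.v *)
(** Noetherian induction: a z-ideal that is maximal among those without such a
    representation cannot be z-irreducible, so it is the intersection of two
    strictly larger z-ideals; these are representable, and hence so is it. *)

Require Import Defs.
From mathcomp Require Import all_boot all_order all_algebra.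
From mathcomp Require Import all_classical.

Local Open Scope classical_set_scope.

(** A counterexample starts a strictly ascending chain of z-ideals violating [P]: by [step], each
    such ideal lies strictly inside another. This contradicts [z_noetherian]. *)
Lemma z_noetherian_ind (S : comPzSemiRingType) (P : set S -> Prop) :
  z_noetherian S ->
  (forall a, z_ideal a ->
     (forall b, z_ideal b -> a `<=` b -> b <> a -> P b) -> P a) ->
  forall a, z_ideal a -> P a.
Proof.
move=> hS step a za; apply: contrapT => nPa.
(* Bundling the proofs into [T] lets choice yield a total map [f] that can be iterated from [a]. *)
pose T := {b : set S | z_ideal b /\ ~ P b}.
have larger (u : T) : exists v : T, sval u `<=` sval v /\ sval v <> sval u.
  case: u => b [zb nPb] /=; apply: contrapT => no_larger.
  apply: nPb; apply: step => // c zc bc c_neq; apply: contrapT => nPc.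
  by apply: no_larger; exists (exist _ c (conj zc nPc)).
have [f f_larger] := choice larger.
pose u0 : T := exist _ a (conj za nPa).
pose I n := sval (iter n f u0).
have zI n : z_ideal (I n) by rewrite /I; case: (iter _ _ _) => b [].
have [|N stationary] := hS I zI; first by move=> n; case: (f_larger (iter n f u0)).
have [_ []] := f_larger (iter N f u0).
exact: (stationary N.+1 (leqnSn N)).
Qed.

Theorem proposition4p30 (S : comPzSemiRingType) (hS : z_noetherian S)
    (a : set S) (ha : z_ideal a) :
  exists F : set (set S),
    [/\ finite_set F, F !=set0,
        forall b, F b -> z_irreducible b
      & a = \bigcap_(b in F) b].
Proof.
move: a ha; apply: z_noetherian_ind => // a za IH.
have [irr|reducible] := pselect (z_irreducible a).
  exists [set a]; split=> //; [by exists a | by move=> _ -> | by rewrite bigcap_set1].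
(* As [a] is a z-ideal, only the splitting condition of z-irreducibility can fail. *)
have [b [b' [zb zb' ab b_neq b'_neq]]] : exists b b',
    [/\ z_ideal b, z_ideal b', b `&` b' = a, b <> a & b' <> a].
  apply: contrapT => no_split; apply: reducible; split=> // b b' zb zb' ab.
  apply: contrapT => /not_orP[b_neq b'_neq].
  by apply: no_split; exists b, b'.
(* Both [b] and [b'] contain their intersection [a], strictly since they differ from it, so [IH]
   applies. *)
have [|F [finF [c Fc] irrF bE]] := IH b zb _ b_neq.
  by rewrite -ab; exact: subIsetl.
have [|F' [finF' _ irrF' b'E]] := IH b' zb' _ b'_neq.
  by rewrite -ab; exact: subIsetr.
exists (F `|` F'); split.
- by rewrite finite_setU.
- by exists c; left.
- by move=> d [/irrF|/irrF'].
- by rewrite bigcap_setU -bE -b'E.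
Qed.
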